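(* Let $P$ be a path connected finite space with order complex $\mathcal{K}(P)$. Then $\mathrm{TCC}(\mathcal{K}(P))\le\mathrm{CC}(P)$.
   Context: A finite space is a finite $T_0$ topological space, identified with a finite poset (open sets are down-sets; continuous maps are order-preserving maps). The order complex $\mathcal{K}(P)$ is the simplicial complex whose $n$-simplices are chains $p_0<\dots<p_n$ in $P$ (taken with its geometric realization). $J_m$ is the finite fence on $\{0,\dots,m\}$ with order $0<1>2<\cdots m$; $P^{J_m}$ is the finite space of continuous maps $J_m\to P$ with the pointwise order; $q_m(\gamma)=(\gamma(0),\gamma(m))$. $\mathrm{CC}_m(P)$ is the smallest $n\ge0$ such that some open cover $\{Q_i\}_{i=1}^n$ of $P\times P$ admits continuous sections $Q_i\to P^{J_m}$ of $q_m$ ($\infty$ if none), and $\mathrm{CC}(P)=\min_{m\ge0}\mathrm{CC}_m(P)$. For a path connected CW complex $X$, $\mathrm{TCC}(X)$ is the smallest $n\ge0$ such that there is a cover $\{Y_i\}_{i=1}^n$ of $X\times X$ by subcomplexes (here $\mathcal{K}(P)\times\mathcal{K}(P)$ is given the cell structure whose cells are products of simplices of $\mathcal{K}(P)$) with a continuous section $Y_i\to X^I$ of the path fibration $p(\gamma)=(\gamma(0),\gamma(1))$ for each $i$, $X^I$ being the space of paths $[0,1]\to X$ in the compact-open topology ($\infty$ if none). *)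

(* Defs.v *)
From HB Require Import structures.
From mathcomp Require Import all_boot all_order all_algebra.
From mathcomp Require Import all_classical all_reals all_analysis.

Set Implicit Arguments.
Unset Strict Implicit.
Unset Printing Implicit Defensive.

Import Order.TTheory GRing.Theory Num.Theory.
Import numFieldNormedType.Exports.
(* Gives [continuousType U V] the compact-open topology. *)
Import ArrowAsCompactOpen.

Local Open Scope classical_set_scope.
Local Open Scope ring_scope.

(* [fspace T] is the carrier of T with the topology whose open sets are the
   down-sets; for finite posets T these are the finite T0 spaces. *)
Definition fspace (d : Order.disp_t) (T : porderType d) : Type := T.

Section FSpace.
Context (d : Order.disp_t) (T : porderType d).

HB.instance Definition _ := Choice.on (fspace T).

Definition down_set (U : set (fspace T)) : Prop :=
  forall x y : T, (x <= y)%O -> U y -> U x.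

Fact down_setT : down_set setT. Proof. by []. Qed.

Fact down_setI : setI_closed down_set.
Proof. by move=> A B dA dB x y xy [Ay By]; split; [exact: dA Ay|exact: dB By]. Qed.

Fact down_set_bigU (I : Type) (f : I -> set (fspace T)) :
  (forall i, down_set (f i)) -> down_set (\bigcup_i f i).
Proof. by move=> df x y xy [i _ fiy]; exists i => //; exact: df fiy. Qed.

HB.instance Definition _ :=
  isOpenTopological.Build (fspace T) down_setT down_setI down_set_bigU.

Lemma fspace_openE : @open (fspace T) = down_set.
Proof. by []. Qed.

End FSpace.

Lemma fspace_continuousP (d1 d2 : Order.disp_t) (S : porderType d1)
    (T : porderType d2) (f : fspace S -> fspace T) :
  continuous f <-> {homo f : x y / (x <= y :> S)%O >-> (x <= y :> T)%O}.
Proof.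
have oE (d : Order.disp_t) (U : porderType d) (A : set (fspace U)) :
  open A = down_set A by rewrite fspace_openE.
rewrite continuousP; split=> [cf x y xy|hf A].
  have /cf : open ([set z | ((z : T) <= (f y : T))%O] : set (fspace T)).
    by rewrite oE => u v uv /= vy; exact: le_trans uv vy.
  by rewrite oE => /(_ x y xy) /=; exact.
by rewrite !oE => dA x y xy; apply: dA; exact: hf.
Qed.

(* The fence 0 < 1 > 2 < ... m: even elements are minimal, odd ones maximal. *)
Definition fence (m : nat) : Type := 'I_m.+1.

Section Fence.
Context (m : nat).

HB.instance Definition _ := Finite.on (fence m).

Definition fence_le (i j : fence m) : bool :=
  (i == j) || odd j && ((i.+1 == j :> nat) || (j.+1 == i :> nat)).

Fact fence_le_refl : reflexive fence_le.
Proof. by move=> i; rewrite /fence_le eqxx. Qed.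

Fact fence_lt_odd (i j : fence m) :
  odd j && ((i.+1 == j :> nat) || (j.+1 == i :> nat)) -> odd j && ~~ odd i.
Proof.
move=> /andP[oj /orP[/eqP e|/eqP e]]; rewrite oj /=.
  by move: oj; rewrite -e.
by rewrite -e /= oj.
Qed.

Fact fence_le_anti : antisymmetric fence_le.
Proof.
move=> i j /andP[/orP[/eqP//|/fence_lt_odd/andP[oj ni]]].
by move=> /orP[/eqP//|/fence_lt_odd/andP[oi nj]]; rewrite oi in ni.
Qed.

Fact fence_le_trans : transitive fence_le.
Proof.
move=> j i k /orP[/eqP->//|ij] /orP[/eqP<-|jk].
  by rewrite /fence_le ij orbT.
case/fence_lt_odd/andP: ij => oj _; case/fence_lt_odd/andP: jk => _.
by rewrite oj.
Qed.

HB.instance Definition _ := Order.Le_isPOrder.Build Order.default_display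
  (fence m) fence_le_refl fence_le_anti fence_le_trans.

End Fence.

(* P^{J_m}: continuous maps J_m -> P, ordered pointwise. *)
Definition fence_maps (m : nat) (d : Order.disp_t) (P : porderType d) : Type :=
  continuousType (fspace (fence m)) (fspace P).

Section FenceMaps.
Context (m : nat) (d : Order.disp_t) (P : porderType d).

HB.instance Definition _ := Choice.on (fence_maps m P).

Definition fence_at (g : fence_maps m P) (i : 'I_m.+1) : P :=
  (g : continuousType _ _) (i : fspace (fence m)).

Definition fence_maps_le (g h : fence_maps m P) : bool :=
  [forall i : 'I_m.+1, (fence_at g i <= fence_at h i)%O].

Fact fence_maps_le_refl : reflexive fence_maps_le.
Proof. by move=> g; apply/forallP. Qed.

Fact fence_maps_le_anti : antisymmetric fence_maps_le.
Proof.
move=> g h /andP[/forallP gh /forallP hg]; apply/continuousEP => i.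
by apply: (@le_anti _ P); rewrite (gh i) (hg i).
Qed.

Fact fence_maps_le_trans : transitive fence_maps_le.
Proof.
move=> g f h /forallP fg /forallP gh; apply/forallP => i.
exact: le_trans (fg i) (gh i).
Qed.

HB.instance Definition _ := Order.Le_isPOrder.Build Order.default_display
  (fence_maps m P) fence_maps_le_refl fence_maps_le_anti fence_maps_le_trans.

Definition fence_ends (g : fspace (fence_maps m P)) : fspace P * fspace P :=
  (fence_at g ord0, fence_at g ord_max).

End FenceMaps.

Definition continuous_section (B E : topologicalType) (p : E -> B) (Y : set B)
    : Prop :=
  exists s : B -> E, {within Y, continuous s} /\ (forall y, Y y -> p (s y) = y).

(* Subsets of nat have an attained infimum, or +oo when they are empty: see
   [smallestP]. *)
Definition smallest (R : realType) (A : set nat) : \bar R :=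
  ereal_inf [set (n%:R%:E : \bar R) | n in A].

Lemma smallestP (R : realType) (A : set nat) :
  (A = set0 -> smallest R A = +oo%E) /\
  (A !=set0 -> exists2 n, A n & smallest R A = n%:R%:E /\
                                forall k, A k -> (n <= k)%N).
Proof.
split=> [->|[n0 An0]]; first by rewrite /smallest image_set0 ereal_inf0.
have exA : exists n, `[< A n >] by exists n0; apply/asboolP.
case: (ex_minnP exA) => n /asboolP An nmin.
have {}nmin k : A k -> (n <= k)%N by move=> Ak; apply/nmin/asboolP.
exists n => //; split=> //; apply/eqP; rewrite eq_le; apply/andP; split.
  by apply: ereal_inf_lbound; exists n.
by apply: le_ereal_inf_tmp => _ [k Ak <-]; rewrite lee_fin ler_nat nmin.
Qed.

Section CombinatorialComplexity.
Context (R : realType) (d : Order.disp_t) (P : porderType d).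

Definition CC_cover (m n : nat) : Prop :=
  exists Q : 'I_n -> set (fspace P * fspace P),
    [/\ forall i, open (Q i),
        \bigcup_i Q i = setT &
        forall i, continuous_section (@fence_ends m d P) (Q i)].

Definition CC_ (m : nat) : \bar R := smallest R (CC_cover m).

Definition CC : \bar R := ereal_inf (range CC_).

End CombinatorialComplexity.

Definition unit_interval (R : realType) : Type := set_type (`[0, 1]%classic : set R).

HB.instance Definition _ (R : realType) := Topological.on (unit_interval R).

Section UnitInterval.
Context (R : realType).

Lemma itv01_0 : (0 : R) \in (`[0, 1]%classic : set R).
Proof. by rewrite inE /= in_itv /= lexx ler01. Qed.

Lemma itv01_1 : (1 : R) \in (`[0, 1]%classic : set R).
Proof. by rewrite inE /= in_itv /= lexx ler01. Qed.

Definition I0 : unit_interval R := SigSub itv01_0.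
Definition I1 : unit_interval R := SigSub itv01_1.

End UnitInterval.

(* X^I, with the compact-open topology. *)
Definition path_space (R : realType) (X : topologicalType) : topologicalType :=
  continuousType (unit_interval R) X.

Definition path_ends (R : realType) (X : topologicalType)
    (g : path_space R X) : X * X :=
  let g' : continuousType (unit_interval R) X := g in (g' (I0 R), g' (I1 R)).

Definition path_connected (R : realType) (X : topologicalType) : Prop :=
  forall x y : X, exists g : path_space R X, path_ends g = (x, y).

(* [C] is the collection of open cells of a CW structure on X. *)
Definition subcomplex (X : topologicalType) (C : set (set X)) (Y : set X)
    : Prop :=
  closed Y /\ exists2 D : set (set X), D `<=` C & Y = \bigcup_(e in D) e.

Section TCC.
Context (R : realType) (X : topologicalType) (C : set (set (X * X))).

Definition TCC_cover (n : nat) : Prop :=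
  exists Y : 'I_n -> set (X * X),
    [/\ forall i, subcomplex C (Y i),
        \bigcup_i Y i = setT &
        forall i, continuous_section (@path_ends R X) (Y i)].

Definition TCC : \bar R := smallest R TCC_cover.

End TCC.

Definition product_cells (X Y : Type) (C : set (set X)) (D : set (set Y))
    : set (set (X * Y)) :=
  [set e | exists c, exists d, [/\ C c, D d & e = c `*` d]].

Section Realization.
Context (R : realType) (V : finType) (K : {set {set V}}).

Definition weight_support (x : {ptws V -> R}) : {set V} := [set v | x v != 0]%SET.

(* Barycentric coordinates; as V is finite, the topology induced by R^V is the
   usual (coherent) topology of the geometric realization. *)
Definition realization_set : set {ptws V -> R} :=
  [set x | [/\ forall v, 0 <= x v, \sum_v x v = 1 & weight_support x \in K]].

Definition realization : topologicalType := set_type realization_set.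

Definition open_simplex (s : {set V}) : set realization :=
  [set x : set_type realization_set | weight_support (set_val x) = s].

Definition open_simplices : set (set realization) :=
  [set e | exists2 s, s \in K & e = open_simplex s].

End Realization.

Arguments realization R {V} K.
Arguments open_simplices R {V} K.

Definition order_complex (d : Order.disp_t) (P : finPOrderType d)
    : {set {set P}} :=
  [set s : {set P} | (s != finset.set0) &&
     [forall x in s, [forall y in s, (x >=< y)%O]]]%SET.

(* Main.v *)
(* Cover K(P) x K(P) by the unions Y_i of the cells sigma x tau with
   sigma x tau contained in Q_i.  A point of the realization is a probability
   weight on a chain; cutting [0, 1] into consecutive intervals of the given
   lengths, in increasing order along the chain, turns it into a monotone step
   function.  Superposing the step functions of x, y and of a point u of
   [0, m] = K(J_m), and applying the monotone map Q_i x J_m -> P adjoint to the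
   section over Q_i, gives a weight on a chain of P whose entries are sums of
   lengths of intersections of three intervals, hence continuous in (x, y, u).
   At u = 0 and u = m it is x and y. *)
Require Import Defs.
From mathcomp Require Import all_boot all_order all_algebra.
From mathcomp Require Import all_classical all_reals all_analysis.
From mathcomp Require Import lra.

Set Implicit Arguments.
Unset Strict Implicit.
Unset Printing Implicit Defensive.

Import Order.TTheory GRing.Theory Num.Theory.
Import numFieldNormedType.Exports.
Import ArrowAsCompactOpen.

Local Open Scope classical_set_scope.
Local Open Scope ring_scope.

(** Comparisons are split from the inside out: a condition that still contains an [if] is skipped
    until its own operands are resolved. *)
Ltac case_minmax := rewrite ?maxEle ?minEle; repeat match goal with
  |- context [if ?a <= ?b then _ else _] =>
    lazymatch constr:((a, b)) with
    | context [if _ then _ else _] => fail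
    | _ => case: (lerP a b) => ?
    end
  end.

(** Take an element of [s] with the most elements of [T] strictly below it: anything larger in [s]
    would have strictly more. *)
Lemma chain_has_greatest (d : Order.disp_t) (T : finPOrderType d)
    (s : {set T}) : s != finset.set0 -> {in s &, forall a b, (a >=< b)%O} ->
  exists2 t, t \in s & {in s, forall a, (a <= t)%O}.
Proof.
case/finset.set0Pn => a0 a0s schain.
pose below a := finset (fun b : T => b < a)%O.
have [t ts tmax] := @arg_maxnP _ a0 (mem s) (fun a => #|below a|) a0s.
exists t => // a sa; rewrite (comparable_leNgt (schain a t sa ts)).
apply/negP => ta; have := tmax a sa; rewrite /= leqNgt => /negP; apply.
apply: proper_card; apply/properP; split; last by exists t; rewrite !inE ?ltxx.
by apply/fintype.subsetP => b; rewrite !inE => /lt_trans; exact.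
Qed.

(** * Probability weights on chains and the intervals they cut out *)

Section Weights.
Context (R : realType) (d : Order.disp_t) (T : finPOrderType d).
Implicit Types (x : T -> R) (a b c : T).

Definition chain_weight x : Prop := realization_set (order_complex T) x.

Lemma chain_weightP x : chain_weight x <->
  [/\ forall a, 0 <= x a, \sum_a x a = 1 &
      forall a b, x a != 0 -> x b != 0 -> (a >=< b)%O].
Proof.
rewrite /chain_weight /realization_set /=; split=> -[x_ge0 x1 xK]; split=> //.
  move=> a b xa xb; move: xK; rewrite inE => /andP[_ /forall_inP cmp].
  have /forall_inP := cmp a ltac:(by rewrite inE).
  by apply; rewrite inE.
rewrite inE; apply/andP; split.
  apply/eqP => supp0; move/eqP: x1; rewrite big1 1?eq_sym ?oner_eq0// => a _.
  apply/eqP/negPn/negP => xa.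
  have : a \in weight_support x by rewrite inE.
  by rewrite supp0 inE.
apply/forall_inP => a; rewrite inE => xa; apply/forall_inP => b.
by rewrite inE => xb; exact: xK.
Qed.

Definition mass_below x a : R := \sum_(c | (c < a)%O) x c.

(* Stacking the weights of a chain in increasing order cuts [0, total mass] into
   the consecutive intervals [mass_below x a, mass_below x a + x a]. *)
Lemma chain_telescope (phi : R -> R) (s : {set T}) x :
  {in s &, forall a b, (a >=< b)%O} ->
  \sum_(a in s) (phi (\sum_(c in s | (c < a)%O) x c + x a)
                 - phi (\sum_(c in s | (c < a)%O) x c)) =
  phi (\sum_(a in s) x a) - phi 0.
Proof.
(* Induction on the size of the chain. Removing the greatest element [t] leaves the lower sums at
   the other elements unchanged, and the term of [t] is the last difference of the telescope. *)
elim: {s}_.+1 {-2}s (ltnSn #|s|) => // n IHn s; rewrite ltnS => sn schain.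
have [->|s0] := eqVneq s finset.set0; first by rewrite !big_set0 subrr.
have [t ts tmax] := chain_has_greatest s0 schain.
have sDt : (#|s :\ t| < n)%N by move: sn; rewrite (cardsD1 t s) ts.
have lt_t c : (c \in s) && (c < t)%O = (c \in (s :\ t)%SET).
  rewrite !inE lt_neqAle; case: eqP => //= _; rewrite ?andbF//.
  by case: (boolP (c \in s)) => //= /tmax ->.
rewrite (big_setD1 t)//= [\sum_(a in s) x a](big_setD1 t)//= addrC.
rewrite !(eq_bigl _ _ lt_t).
have -> : \sum_(a in (s :\ t)%SET)
    (phi (\sum_(c in s | (c < a)%O) x c + x a)
     - phi (\sum_(c in s | (c < a)%O) x c)) =
    phi (\sum_(a in (s :\ t)%SET) x a) - phi 0.
  rewrite -IHn//; last first.
    by move=> a b; rewrite !inE => /andP[_ sa] /andP[_]; exact: schain.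
  apply: eq_bigr => a; rewrite !inE => /andP[a_t sa].
  suff E c : (c \in s) && (c < a)%O = (c \in (s :\ t)%SET) && (c < a)%O.
    by rewrite !(eq_bigl _ _ E).
  rewrite !inE; have [->|//] := eqVneq c t.
  by rewrite (le_gtF (tmax _ sa)) !andbF.
rewrite [x t + _]addrC; lra.
Qed.

(** Elements outside the support have degenerate intervals, so the sums over the whole poset agree
    with those over the support, which is a chain of total mass 1. *)
Lemma chain_weight_telescope (phi : R -> R) x : chain_weight x ->
  \sum_a (phi (mass_below x a + x a) - phi (mass_below x a)) = phi 1 - phi 0.
Proof.
move=> /chain_weightP[_ x1 xK].
have supp (Q : pred T) :
    \sum_(c in weight_support x | Q c) x c = \sum_(c | Q c) x c.
  rewrite [RHS](bigID (mem (weight_support x)))/= [X in _ + X]big1 ?addr0.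
    by apply: eq_bigl => c; rewrite andbC.
  by move=> c /andP[_]; rewrite inE negbK => /eqP.
have := @chain_telescope phi (weight_support x) x.
have -> : \sum_(a in weight_support x) x a = 1.
  by rewrite -x1 -(supp xpredT); apply: eq_bigl => a; rewrite andbT.
move=> <-; last by move=> a b; rewrite !inE; exact: xK.
rewrite (bigID (mem (weight_support x)))/= [X in _ + X]big1 ?addr0;
  last first.
  by move=> c; rewrite inE negbK => /eqP ->; rewrite addr0 subrr.
by apply: eq_bigr => a _; rewrite !supp.
Qed.

Lemma mass_below_ge0 x a : chain_weight x -> 0 <= mass_below x a.
Proof. by case/chain_weightP => x_ge0 _ _; apply: sumr_ge0. Qed.

Lemma mass_below_lt x a b : chain_weight x -> (a < b)%O ->
  mass_below x a + x a <= mass_below x b.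
Proof.
move=> /chain_weightP[x_ge0 _ _] ab; rewrite addrC {2}/mass_below (bigD1 a)//=.
rewrite lerD2l /mass_below [leRHS]big_mkcond/= [leLHS]big_mkcond/=.
apply: ler_sum => c _; have [ca|_] := boolP (c < a)%O.
  by rewrite (lt_trans ca ab) lt_eqF.
by case: ifP.
Qed.

Lemma mass_below_le1 x a : chain_weight x -> mass_below x a + x a <= 1.
Proof.
move=> /chain_weightP[x_ge0 <- _]; rewrite [leRHS](bigD1 a)//= [leRHS]addrC lerD2r.
rewrite /mass_below [leRHS]big_mkcond/= [leLHS]big_mkcond/=.
apply: ler_sum => c _; have [/lt_eqF ->//|_] := boolP (c < a)%O.
by case: ifP.
Qed.

End Weights.

(** * Superposition of two weights *)

Definition overlap (R : realType) (l h p q : R) : R :=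
  Num.max 0 (Num.min h q - Num.max l p).

Lemma overlapC (R : realType) (l h p q : R) :
  overlap l h p q = overlap p q l h.
Proof. by rewrite /overlap (minC h) (maxC l). Qed.

(** With [phi] the clamp to [[l, h]], the overlap takes the form [phi q - phi p], which
    [chain_weight_telescope] can sum over consecutive intervals [[p, q]]. *)
Lemma overlap_clamp (R : realType) (l h p q : R) : l <= h -> p <= q ->
  overlap l h p q = Num.min h (Num.max l q) - Num.min h (Num.max l p).
Proof.
by rewrite /overlap => lh pq; case_minmax; lra.
Qed.

(** The monotone (quantile) coupling: the joint law of the two step functions at a uniform point of
    [[0, 1]]. *)
Definition coupling (R : realType) (d1 d2 : Order.disp_t)
    (T1 : finPOrderType d1) (T2 : finPOrderType d2)
    (x : T1 -> R) (y : T2 -> R) (c : T1 * T2) : R :=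
  overlap (mass_below x c.1) (mass_below x c.1 + x c.1)
          (mass_below y c.2) (mass_below y c.2 + y c.2).

Lemma coupling_sum_r (R : realType) (d1 d2 : Order.disp_t)
    (T1 : finPOrderType d1) (T2 : finPOrderType d2)
    (x : T1 -> R) (y : T2 -> R) a :
  chain_weight x -> chain_weight y -> \sum_b coupling x y (a, b) = x a.
Proof.
move=> xP yP; have [x_ge0 _ _] := (chain_weightP x).1 xP.
have [y_ge0 _ _] := (chain_weightP y).1 yP.
pose l := mass_below x a; pose h := mass_below x a + x a.
rewrite (eq_bigr (fun b =>
    Num.min h (Num.max l (mass_below y b + y b))
    - Num.min h (Num.max l (mass_below y b)))); last first.
  by move=> b _; rewrite /coupling overlap_clamp// lerDl.
(* The intervals of [y] tile [[0, 1]], so the sum is the clamp at 1 minus the clamp at 0. As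
   [0 <= l <= h <= 1], this is [h - l = x a]. *)
rewrite (chain_weight_telescope (fun t => Num.min h (Num.max l t)))//.
have := mass_below_le1 a xP; have := mass_below_ge0 a xP.
rewrite -/h -/l => l0 h1; have lh : l <= h by rewrite lerDl.
have E : h = l + x a by [].
rewrite (max_r (le_trans lh h1)) (max_l l0) (min_l h1) (min_r lh); lra.
Qed.

Lemma coupling_sum_l (R : realType) (d1 d2 : Order.disp_t)
    (T1 : finPOrderType d1) (T2 : finPOrderType d2)
    (x : T1 -> R) (y : T2 -> R) b :
  chain_weight x -> chain_weight y -> \sum_a coupling x y (a, b) = y b.
Proof.
move=> xP yP; rewrite -(coupling_sum_r b yP xP).
by apply: eq_bigr => a _; rewrite /coupling overlapC.
Qed.

(** A positive overlap puts both left ends strictly below both right ends. The two mixed comparisons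
    are the stated inequalities; the other two say that neither interval is degenerate. *)
Lemma coupling_supp (R : realType) (d1 d2 : Order.disp_t)
    (T1 : finPOrderType d1) (T2 : finPOrderType d2)
    (x : T1 -> R) (y : T2 -> R) c : coupling x y c != 0 ->
  [/\ x c.1 != 0, y c.2 != 0,
      mass_below x c.1 < mass_below y c.2 + y c.2 &
      mass_below y c.2 < mass_below x c.1 + x c.1].
Proof.
case: c => a b /=; rewrite /coupling/= /overlap.
set l := mass_below x a; set p := mass_below y b => z0.
have {z0} : Num.max l p < Num.min (l + x a) (p + y b).
  rewrite ltNge; apply: contra z0 => le_hl; apply/eqP/max_l.
  by rewrite subr_le0.
rewrite gt_max !lt_min => /andP[/andP[lx lq] /andP[ph py]]; split=> //.
  by apply: contraTneq lx => ->; rewrite addr0 ltxx.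
by apply: contraTneq py => ->; rewrite addr0 ltxx.
Qed.

Lemma coupling_chain_weight (R : realType) (d1 d2 : Order.disp_t)
    (T1 : finPOrderType d1) (T2 : finPOrderType d2)
    (x : T1 -> R) (y : T2 -> R) :
  chain_weight x -> chain_weight y ->
  chain_weight (coupling x y : (T1 *p T2)%type -> R).
Proof.
move=> xP yP; apply/chain_weightP; split.
- by move=> c; rewrite /coupling /overlap le_max lexx.
- have [_ <- _] := (chain_weightP x).1 xP.
  rewrite -(eq_bigr _ (fun a _ => coupling_sum_r a xP yP)).
  by rewrite pair_big/=; apply: eq_bigr => -[].
- have [x_ge0 _ xK] := (chain_weightP x).1 xP.
  have [y_ge0 _ yK] := (chain_weightP y).1 yP.
  move=> [a b] [a' b'] /coupling_supp/=[xa yb lt1 lt2].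
  move=> /coupling_supp/=[xa' yb' lt1' lt2'].
  rewrite /Order.comparable !Order.ProdOrder.leEprod/=.
  (* Only a crossing such as [a < a'] with [b' < b] could break comparability. It would give the
     cycle: left end of [b] < right end of [a] <= left end of [a'] < right end of [b'] <= left end
     of [b]. *)
  case: (comparable_ltgtP (yK _ _ yb yb')) => [bb'|bb'|_].
  + case: (comparable_ltgtP (xK _ _ xa xa')) => [//|aa'|_]; rewrite ?lexx//.
    have := mass_below_lt xP aa'; have := mass_below_lt yP bb'; lra.
  + case: (comparable_ltgtP (xK _ _ xa xa')) => [aa'|//|_]; rewrite ?lexx//.
    have := mass_below_lt xP aa'; have := mass_below_lt yP bb'; lra.
  + by rewrite !andbT; exact: xK.
Qed.

(** * Images of weights under maps of vertices *)

Section Pushforward.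
Context (R : realType) (S T : finType).

Definition pushforward (f : S -> T) (z : S -> R) (v : T) : R :=
  \sum_(c | f c == v) z c.

Lemma eq_pushforward (f g : S -> T) (z : S -> R) :
  (forall c, z c != 0 -> f c = g c) -> pushforward f z = pushforward g z.
Proof.
move=> fg; apply/funext => v; rewrite /pushforward big_mkcond/= [RHS]big_mkcond.
apply: eq_bigr => c _; have [->|/fg ->//] := eqVneq (z c) 0.
by rewrite !if_same.
Qed.

Lemma pushforward_sum (f : S -> T) (z : S -> R) :
  \sum_v pushforward f z v = \sum_c z c.
Proof.
by rewrite [RHS](partition_big f xpredT).
Qed.

Lemma pushforward_supp (f : S -> T) (z : S -> R) v :
  pushforward f z v != 0 -> exists2 c, z c != 0 & f c = v.
Proof.
move=> zv; have [/existsP[c /andP[zc /eqP fc]]|no] :=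
  boolP [exists c, (z c != 0) && (f c == v)]; first by exists c.
move: zv; rewrite /pushforward big1 ?eqxx// => c fc.
apply/eqP/negPn/negP => zc; move/existsPn: no => /(_ c).
by rewrite zc fc.
Qed.

End Pushforward.

(** Monotonicity is asked on the support only, because a local section is known to be monotone only
    over its own open set. *)
Lemma pushforward_chain_weight (R : realType) (d1 d2 : Order.disp_t)
    (S : finPOrderType d1) (T : finPOrderType d2) (f : S -> T) (z : S -> R) :
  (forall a b, z a != 0 -> z b != 0 -> (a <= b)%O -> (f a <= f b)%O) ->
  chain_weight z -> chain_weight (pushforward f z).
Proof.
move=> fmono /chain_weightP[z_ge0 z1 zK]; apply/chain_weightP; split.
- by move=> v; apply: sumr_ge0.
- by rewrite pushforward_sum.
- move=> _ _ /pushforward_supp[a za <-] /pushforward_supp[b zb <-].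
  case/orP: (zK _ _ za zb) => ab; rewrite /Order.comparable.
    by rewrite (fmono _ _ za zb ab).
  by rewrite (fmono _ _ zb za ab) orbT.
Qed.

Lemma pushforward_id (R : realType) (T : finType) (z : T -> R) :
  pushforward id z = z.
Proof. by apply/funext => v; rewrite /pushforward big_pred1_eq. Qed.

Lemma pushforward_coupling_l (R : realType) (d1 d2 : Order.disp_t)
    (T1 : finPOrderType d1) (T2 : finPOrderType d2) (T : finType)
    (x : T1 -> R) (y : T2 -> R) (g : T1 -> T) :
  chain_weight x -> chain_weight y ->
  pushforward (fun c : T1 * T2 => g c.1) (coupling x y) = pushforward g x.
Proof.
move=> xP yP; apply/funext => v; rewrite /pushforward.
rewrite -(eq_bigr _ (fun a _ => coupling_sum_r a xP yP)) pair_big_dep/=.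
by apply: eq_big => -[a b] //=; rewrite andbT.
Qed.

Lemma pushforward_coupling_r (R : realType) (d1 d2 : Order.disp_t)
    (T1 : finPOrderType d1) (T2 : finPOrderType d2) (T : finType)
    (x : T1 -> R) (y : T2 -> R) (g : T2 -> T) :
  chain_weight x -> chain_weight y ->
  pushforward (fun c : T1 * T2 => g c.2) (coupling x y) = pushforward g y.
Proof.
move=> xP yP; apply/funext => v; rewrite /pushforward.
rewrite -(eq_bigr _ (fun b _ => coupling_sum_l b xP yP)) exchange_big/=.
by rewrite pair_big_dep/=; apply: eq_big => -[a b].
Qed.

(** * Barycentric coordinates on the fence, with [[0, 1]] rescaled to [[0, m]] *)

Section Hat.
Context (R : realType) (m : nat).
Implicit Types (u : R) (k : fence m).

Definition clamp01 (t : R) : R := Num.max 0 (Num.min 1 t).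

(* This is the tent [max 0 (1 - `|m u - k|)]; written as a difference of clamps,
   the sum over [k] telescopes. *)
Definition hat u k : R :=
  clamp01 (m%:R * u - (k : 'I_m.+1)%:R + 1)
  - clamp01 (m%:R * u - (k : 'I_m.+1)%:R).

Lemma clamp01_le0 t : t <= 0 -> clamp01 t = 0.
Proof. by rewrite /clamp01 => t0; case_minmax; lra. Qed.

Lemma clamp01_ge1 t : 1 <= t -> clamp01 t = 1.
Proof. by rewrite /clamp01 => t1; case_minmax; lra. Qed.

Lemma clamp01_mono s t : s <= t -> clamp01 s <= clamp01 t.
Proof. by rewrite /clamp01 => st; case_minmax; lra. Qed.

Lemma hat_supp u k : hat u k != 0 ->
  (k : 'I_m.+1)%:R - 1 < m%:R * u < (k : 'I_m.+1)%:R + 1.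
Proof.
rewrite /hat; move: (m%:R * u) (_%:R) => v w uk.
apply/andP; split; rewrite ltNge; apply: contra uk => uk; apply/eqP.
  by rewrite !clamp01_le0; lra.
by rewrite !clamp01_ge1; lra.
Qed.

Lemma fence_comparable k l : ((k : 'I_m.+1) <= (l : 'I_m.+1).+1)%N ->
  ((l : 'I_m.+1) <= (k : 'I_m.+1).+1)%N -> (k >=< l)%O.
Proof.
move=> kl lk; rewrite /Order.comparable /Order.le/= /fence_le.
have [->//|kNl] := eqVneq k l; rewrite /=.
have [E|E] : (val k).+1 = val l \/ (val l).+1 = val k.
- have : (val k != val l)%N by [].
  by case: (ltngtP (val k) (val l)) => // H _; [left|right]; apply/eqP;
    rewrite eqn_leq ?kl ?lk ?andbT.
- by rewrite -!E !eqxx /= ?orbT/=; case: (odd _).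
- by rewrite -!E !eqxx /= ?orbT/=; case: (odd _).
Qed.

Lemma hat_chain_weight u : 0 <= u <= 1 -> chain_weight (hat u).
Proof.
move=> /andP[u0 u1]; apply/chain_weightP; split.
- by move=> k; rewrite subr_ge0 clamp01_mono// lerDl.
- transitivity (\sum_(0 <= i < m.+1) (clamp01 (m%:R * u - i%:R + 1)
      - clamp01 (m%:R * u - i%:R))); first by rewrite big_mkord.
  (* Since [m u - i = m u - (i + 1) + 1], both clamps are values of one function, at consecutive
     indices. *)
  rewrite (eq_big_nat _ _ (F2 := fun i => - clamp01 (m%:R * u - i.+1%:R + 1)
      - - clamp01 (m%:R * u - i%:R + 1))); last first.
    move=> i _; rewrite opprK addrC; congr (- clamp01 _ + _).
    by rewrite -[i.+1]addn1 natrD opprD addrA subrK.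
  (* What remains are the clamps of [m u + 1 >= 1] and of [m u - m <= 0], that is 1 and 0. *)
  rewrite telescope_sumr// -addn1 natrD subr0.
  have mu : 0 <= m%:R * u <= m%:R by rewrite mulr_ge0//= ler_piMr.
  by rewrite clamp01_le0 1?clamp01_ge1; lra.
(* Both indices are at distance less than 1 from [m u], so they differ by less than 2: they are
   equal or neighbours in the fence. *)
- move=> k l /hat_supp/andP[k1 k2] /hat_supp/andP[l1 l2].
  by apply: fence_comparable; rewrite -ltnS -(ltr_nat R) -[_.+2]addn2 natrD; lra.
Qed.

Lemma hat0_supp k : hat 0 k != 0 -> k = ord0 :> 'I_m.+1.
Proof.
move=> /hat_supp/andP[k1 _]; apply/val_inj/eqP; rewrite /= -leqn0 -ltnS.
by rewrite -(ltr_nat R); lra.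
Qed.

Lemma hat1_supp k : hat 1 k != 0 -> k = ord_max :> 'I_m.+1.
Proof.
move=> /hat_supp/andP[_ k1]; apply/val_inj/eqP; rewrite /= eqn_leq.
rewrite leq_ord/= -ltnS -(ltr_nat R) -addn1 natrD; lra.
Qed.

End Hat.

(** * Continuity on products of finite spaces in terms of the order *)

Lemma open_prod_fspace (d1 d2 : Order.disp_t) (T1 : porderType d1)
    (T2 : porderType d2) (Q : set (fspace T1 * fspace T2)) (a a' : T1)
    (b b' : T2) :
  open Q -> (a' <= a)%O -> (b' <= b)%O -> Q (a, b) -> Q (a', b').
Proof.
(* [Q] contains a box of open sets around [(a, b)]; its sides are down-sets, hence contain [a'] and
   [b']. *)
rewrite openE => oQ aa bb /oQ[[A B] /= [+ +] ABQ].
rewrite !nbhsE => -[U [oU Ua] UA] [V [oV Vb] VB].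
apply: ABQ; split => /=; [apply: UA|apply: VB].
  by move: oU; rewrite fspace_openE => /(_ a' a aa); exact.
by move: oV; rewrite fspace_openE => /(_ b' b bb); exact.
Qed.

Lemma nbhs_prod_fspace (d1 d2 : Order.disp_t) (T1 : porderType d1)
    (T2 : porderType d2) (A : set (fspace T1 * fspace T2)) (a a' : T1)
    (b b' : T2) :
  nbhs ((a, b) : fspace T1 * fspace T2) A ->
  (a' <= a)%O -> (b' <= b)%O -> A (a', b').
Proof.
rewrite nbhsE => -[U [oU Uab] UA] aa bb.
by apply: UA; exact: (open_prod_fspace oU aa bb).
Qed.

(** The principal down-set of [s (a, b)] is open, so its preimage is a neighbourhood of [(a, b)]
    relative to [Q], and such a neighbourhood contains every point of [Q] below [(a, b)]. *)
Lemma within_fspace_homo (d1 d2 d : Order.disp_t) (T1 : porderType d1)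
    (T2 : porderType d2) (T : porderType d) (Q : set (fspace T1 * fspace T2))
    (s : fspace T1 * fspace T2 -> fspace T) (a a' : T1) (b b' : T2) :
  {within Q, continuous s} -> Q (a', b') -> Q (a, b) ->
  (a' <= a)%O -> (b' <= b)%O -> (s (a', b') <= s (a, b) :> T)%O.
Proof.
move=> /subspace_continuousP cs Qab' Qab aa bb.
have oU : open ([set t | (t <= s (a, b) :> T)%O] : set (fspace T)).
  by rewrite fspace_openE => u v uv /= vs; exact: le_trans uv vs.
have /cs : Q (a, b) by [].
move=> /(_ _ (open_nbhs_nbhs (conj oU (lexx _))))/nbhs_prod_fspace.
by move=> /(_ a' b' aa bb); exact.
Qed.

(** * Continuity into the realization, coordinate by coordinate *)

Section RealizationTopology.
Context (R : realType) (V : finType) (K : {set {set V}}).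

Lemma continuous_coordinate (X : topologicalType) (f : X -> realization R K)
  (v : V) : continuous f -> continuous (fun t => set_val (f t) v).
Proof.
move=> cf t; apply: (@continuous_comp _ {ptws V -> R} R (set_val \o f) (@^~ v)).
  by apply: continuous_comp; [exact: cf|exact: initial_continuous].
exact: proj_continuous.
Qed.

Lemma continuous_realization (X : topologicalType) (f : X -> realization R K) :
  (forall v, continuous (fun t => set_val (f t) v)) -> continuous f.
Proof.
move=> cf; apply: continuous_comp_initial => t; apply/cvg_sup => v.
exact: (@continuous_comp_initial _ _ _ (fun g : forall i : V, R => g v)
  (set_val \o f) (cf v) t).
Qed.

End RealizationTopology.

Section ContinuousWeights.
Context (R : realType) (X : topologicalType).

Lemma continuous_sumr (I : finType) (P : pred I) (F : X -> I -> R) :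
  (forall i, continuous (F^~ i)) ->
  continuous (fun t => \sum_(i | P i) F t i).
Proof.
move=> cF; apply: (@continuous_big _ _ +%R 0 P _ X _ (fun i => F^~ i)).
  exact: add_continuous.
by move=> i _; exact: cF.
Qed.

Lemma continuous_maxr (f g : X -> R) :
  continuous f -> continuous g -> continuous (fun t => Num.max (f t) (g t)).
Proof. by move=> cf cg t; exact: (continuous_max (cf t) (cg t)). Qed.

Lemma continuous_minr (f g : X -> R) :
  continuous f -> continuous g -> continuous (fun t => Num.min (f t) (g t)).
Proof. by move=> cf cg t; exact: (continuous_min (cf t) (cg t)). Qed.

Lemma continuous_coupling (d1 d2 : Order.disp_t) (T1 : finPOrderType d1)
    (T2 : finPOrderType d2) (x : X -> T1 -> R) (y : X -> T2 -> R) :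
  (forall a, continuous (x^~ a)) -> (forall b, continuous (y^~ b)) ->
  forall c, continuous (fun t => coupling (x t) (y t) c).
Proof.
move=> cx cy [a b]; rewrite /coupling /overlap /=.
have cl := continuous_sumr (P := fun c => (c < a)%O) cx.
have cp := continuous_sumr (P := fun c => (c < b)%O) cy.
apply: continuous_maxr; first exact: cst_continuous.
move=> t; apply: cvgB; last exact: (continuous_maxr cl cp).
apply: continuous_minr => {}t; first exact: cvgD (cl t) (cx a t).
exact: cvgD (cp t) (cy b t).
Qed.

Lemma continuous_pushforward (S T : finType) (f : S -> T) (z : X -> S -> R) :
  (forall c, continuous (z^~ c)) ->
  forall v, continuous (fun t => pushforward f (z t) v).
Proof. by move=> cz v; exact: continuous_sumr. Qed.

Lemma continuous_hat (m : nat) (u : X -> R) : continuous u ->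
  forall k, continuous (fun t => @hat R m (u t) k).
Proof.
move=> cu k; rewrite /hat.
have cmu : continuous (fun t => m%:R * u t - (k : 'I_m.+1)%:R).
  move=> t; apply: cvgB; last exact: cvg_cst.
  by apply: cvgM; [exact: cvg_cst|exact: cu].
have cclamp (v : X -> R) : continuous v -> continuous (fun t => clamp01 (v t)).
  move=> cv; apply: continuous_maxr; first exact: cst_continuous.
  by apply: continuous_minr => //; exact: cst_continuous.
move=> t; apply: cvgB; last exact: cclamp.
by apply: cclamp => {}t; apply: cvgD; [exact: cmu|exact: cvg_cst].
Qed.

End ContinuousWeights.

(** * From a section over [Q] to a section of the path fibration *)

Section LiftedSection.
Context (R : realType) (d : Order.disp_t) (P : finPOrderType d) (m : nat).
Context (Q : set (fspace P * fspace P)).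
Context (s : fspace P * fspace P -> fspace (fence_maps m P)).

Local Notation KP := (realization R (order_complex P)).

(** Stated through supports, this set can be read both as a union of open cells and as a common zero
    set of products of coordinates. *)
Definition supported_in : set (KP * KP) :=
  [set xy | forall a b, set_val xy.1 a != 0 -> set_val xy.2 b != 0 -> Q (a, b)].

Lemma realization_chain_weight (x : KP) : chain_weight (set_val x).
Proof. exact: (set_mem (svalP x)). Qed.

Lemma supported_in_subcomplex : open Q ->
  subcomplex (product_cells (open_simplices R (order_complex P))
                            (open_simplices R (order_complex P))) supported_in.
Proof.
move=> oQ; split.
  (* Closedness: for each pair outside [Q], one of the two coordinates must vanish, which is a
     closed condition on their product. *)
  rewrite (_ : supported_in = \bigcap_(ab in ~` Q)
      [set xy | set_val xy.1 ab.1 * set_val xy.2 ab.2 = 0]).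
    apply: closed_bigI => -[a b] _ /=.
    apply: (@preimage_closed _ _
      (fun xy : KP * KP => set_val xy.1 a * set_val xy.2 b) [set x | x = 0]).
      move=> xy _; apply: cvgM.
        by apply: continuous_coordinate => {}xy; exact: cvg_fst.
      by apply: continuous_coordinate => {}xy; exact: cvg_snd.
    exact: closed_eq.
  apply/seteqP; split=> [xy Qxy [a b] /= nQ|xy Qxy a b xa yb].
    apply/eqP; rewrite mulf_eq0; apply: contra_notT nQ.
    by rewrite negb_or => /andP[]; exact: Qxy.
  apply: contrapT => nQ; have /= /eqP := Qxy (a, b) nQ.
  by rewrite mulf_eq0 (negbTE xa) (negbTE yb).
(* Take all open cells contained in the set. The cell carrying [(x, y)] is one of them, since both
   supports are constant on it. *)
exists [set e | product_cells (open_simplices R (order_complex P))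
  (open_simplices R (order_complex P)) e /\ e `<=` supported_in].
  by move=> e [].
apply/seteqP; split=> [[x y] Qxy|xy [e [_ eQ]] /eQ//].
exists (open_simplex (weight_support (set_val x))
  `*` open_simplex (weight_support (set_val y))) => //; split.
  exists (open_simplex (weight_support (set_val x))).
  exists (open_simplex (weight_support (set_val y))); split=> //.
    exists (weight_support (set_val x)) => //.
    by have [] := set_mem (svalP x).
  exists (weight_support (set_val y)) => //.
  by have [] := set_mem (svalP y).
move=> [x' y'] [/= + +] a b xa yb; rewrite /open_simplex/= => Ex Ey.
apply: Qxy => /=.
  by move/setP: Ex => /(_ a); rewrite !inE xa => <-.
by move/setP: Ey => /(_ b); rewrite !inE yb => <-.
Qed.

Definition fence_eval (c : (P * P) * fence m) : P :=
  fence_at (s c.1) (c.2 : 'I_m.+1).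

Definition lifted_weight (x y : P -> R) (u : R) : P -> R :=
  pushforward fence_eval
    (coupling (coupling x y : (P *p P)%type -> R) (@hat R m u)).

Hypothesis s_cont : {within Q, continuous s}.
Hypothesis s_ends : forall p, Q p -> fence_ends (s p) = p.

Lemma fence_at_homo (g : fence_maps m P) (i j : fence m) :
  (i <= j)%O -> (fence_at g i <= fence_at g j)%O.
Proof.
move=> ij; apply: (proj1 (@fspace_continuousP _ _ (fence m) P g)) => //.
exact: cts_fun.
Qed.

Lemma lifted_weight_chain_weight (x y : KP) (u : R) :
  supported_in (x, y) -> 0 <= u <= 1 ->
  chain_weight (lifted_weight (set_val x) (set_val y) u).
Proof.
move=> Qxy u01; have xP := realization_chain_weight x.
have yP := realization_chain_weight y.
apply: (@pushforward_chain_weight _ _ _ ((P *p P)%type *p fence m)%type).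
  move=> [[a b] k] [[a' b'] k'].
  move=> /coupling_supp[/coupling_supp/=[xa yb _ _] _ _ _].
  move=> /coupling_supp[/coupling_supp/=[xa' yb' _ _] _ _ _].
  rewrite !Order.ProdOrder.leEprod/= => /andP[/andP[aa bb] kk].
  (* First move along the fence inside the single map [s (a, b)], then compare the maps [s (a, b)]
     and [s (a', b')] at the fixed index [k']. *)
  apply: (@le_trans _ _ (fence_at (s (a, b)) k')).
    exact: fence_at_homo.
  have := within_fspace_homo s_cont (Qxy _ _ xa yb) (Qxy _ _ xa' yb') aa bb.
  by move=> /forallP; exact.
apply: coupling_chain_weight; last exact: hat_chain_weight.
exact: coupling_chain_weight.
Qed.

Lemma lifted_weight0 (x y : KP) : supported_in (x, y) ->
  lifted_weight (set_val x) (set_val y) 0 = set_val x.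
Proof.
move=> Qxy; have xP := realization_chain_weight x.
have yP := realization_chain_weight y.
have hP : chain_weight (@hat R m 0)
  by apply: hat_chain_weight; rewrite lexx ler01.
have xyP := coupling_chain_weight xP yP.
(* At [u = 0] only index 0 of the fence has weight, and there [s (a, b)] takes the value [a]. On the
   support [fence_eval] is thus a projection, and the marginal of the coupling is [x]. *)
rewrite /lifted_weight (@eq_pushforward _ _ _ _ (fun c => c.1.1)).
  rewrite (pushforward_coupling_l (fun c : (P *p P)%type => c.1) xyP hP).
  by rewrite (pushforward_coupling_l id xP yP) pushforward_id.
move=> [[a b] k] /coupling_supp[/coupling_supp/=[xa yb _ _] /hat0_supp k0 _ _].
by have [] := s_ends (Qxy _ _ xa yb); rewrite /fence_eval /= k0.
Qed.

Lemma lifted_weight1 (x y : KP) : supported_in (x, y) ->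
  lifted_weight (set_val x) (set_val y) 1 = set_val y.
Proof.
move=> Qxy; have xP := realization_chain_weight x.
have yP := realization_chain_weight y.
have hP : chain_weight (@hat R m 1)
  by apply: hat_chain_weight; rewrite lexx ler01.
have xyP := coupling_chain_weight xP yP.
rewrite /lifted_weight (@eq_pushforward _ _ _ _ (fun c => c.1.2)).
  rewrite (pushforward_coupling_l (fun c : (P *p P)%type => c.2) xyP hP).
  by rewrite (pushforward_coupling_r id xP yP) pushforward_id.
move=> [[a b] k] /coupling_supp[/coupling_supp/=[xa yb _ _] /hat1_supp k1 _ _].
by have [] := s_ends (Qxy _ _ xa yb); rewrite /fence_eval /= k1.
Qed.

Definition Ival (u : unit_interval R) : R := set_val u.

Lemma Ival01 (u : unit_interval R) : 0 <= Ival u <= 1.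
Proof. by have := set_mem (svalP u); rewrite /= in_itv. Qed.

Lemma Ival_continuous : continuous Ival.
Proof. exact: initial_continuous. Qed.

Definition lifted_map (p : set_type supported_in * unit_interval R) : KP :=
  SigSub (mem_set (lifted_weight_chain_weight (x := (set_val p.1).1)
    (y := (set_val p.1).2) (set_mem (svalP p.1)) (Ival01 p.2))).

Lemma lifted_map_continuous : continuous lifted_map.
Proof.
have cY : continuous
    (fun p : set_type supported_in * unit_interval R => set_val p.1).
  move=> p; apply: (@continuous_comp _ _ _ fst set_val); first exact: cvg_fst.
  exact: initial_continuous.
apply: continuous_realization; apply: continuous_pushforward.
pose X : topologicalType := (set_type supported_in * unit_interval R)%type.
pose z (p : X) : (P *p P)%type -> R :=
  coupling (set_val (set_val p.1).1) (set_val (set_val p.1).2).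
have cz : forall c, continuous (z^~ c).
  apply: continuous_coupling => a; apply: continuous_coordinate => p.
    exact: continuous_comp (cY p) (@cvg_fst _ _ _ _ _).
  exact: continuous_comp (cY p) (@cvg_snd _ _ _ _ _).
have ch : forall k, continuous (fun p : X => @hat R m (Ival p.2) k).
  apply: continuous_hat => p.
  by apply: (@continuous_comp _ _ _ snd Ival);
    [exact: cvg_snd|exact: Ival_continuous].
exact: continuous_coupling cz ch.
Qed.

(** Currying [lifted_map] has two outcomes: each path is continuous, used here, and the path depends
    continuously on its ends for the compact-open topology, used next. *)
Definition lifted_path (xy : set_type supported_in) : path_space R KP :=
  mkcts ((continuous_curry lifted_map_continuous).2 xy).

Lemma lifted_path_continuous : continuous lifted_path.
Proof.
apply: continuous_comp_initial.
exact: (continuous_curry lifted_map_continuous).1.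
Qed.

Lemma lifted_path_ends (xy : set_type supported_in) :
  path_ends (lifted_path xy) = set_val xy.
Proof.
have xyY := set_mem (svalP xy).
rewrite [RHS]surjective_pairing; congr (_, _); apply: val_inj => /=.
  by apply: lifted_weight0.
by apply: lifted_weight1.
Qed.

Lemma supported_in_section :
  continuous_section (@path_ends R KP) supported_in.
Proof.
(* A section is a total function, so constant paths serve as default values off [supported_in];
   continuity within that set only concerns the restriction. *)
pose gam (xy : KP * KP) : path_space R KP :=
  if pselect (supported_in xy) is left Yxy
  then lifted_path (SigSub (mem_set Yxy))
  else mkcts (@cst_continuous (unit_interval R) KP xy.1).
exists gam; split.
  apply/subspace_sigL_continuousP.
  rewrite (_ : sigL _ _ = lifted_path); first exact: lifted_path_continuous.
  apply/funext => xy; rewrite /sigL /gam /=; case: pselect => [Yxy|].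
    by congr lifted_path; exact: val_inj.
  by have := set_mem (svalP xy).
move=> xy Yxy; rewrite /gam; case: pselect => // Yxy'.
by rewrite lifted_path_ends.
Qed.

End LiftedSection.

(** * Comparison of the covers and of the invariants *)

Lemma CC_cover_TCC_cover (R : realType) (d : Order.disp_t) (P : finPOrderType d)
    (m n : nat) : CC_cover P m n ->
  TCC_cover R (product_cells (open_simplices R (order_complex P))
                             (open_simplices R (order_complex P))) n.
Proof.
move=> [Q [oQ Qcover Qsec]]; exists (fun i => supported_in (Q i)); split.
- by move=> i; exact: supported_in_subcomplex.
- apply/seteqP; split=> // -[x y] _.
  (* The greatest elements [a] and [b] of the two supports form a pair in some [Q i], and this
     down-set then contains every pair of support elements. *)
  have greatest (z : realization R (order_complex P)) :
      exists a, forall b, set_val z b != 0 -> (b <= a)%O.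
    have [_ _] := set_mem (svalP z); rewrite inE => /andP[z0 zK].
    have [|t _ tmax] := chain_has_greatest z0.
      move=> a b az bz.
      by have /forall_inP/(_ a az)/forall_inP/(_ b bz) := zK.
    by exists t => b zb; apply: tmax; rewrite inE.
  have [a xa] := greatest x; have [b yb] := greatest y.
  have : (\bigcup_i Q i) (a, b) by rewrite Qcover.
  case=> i _ Qab; exists i => // a' b' /= xa' yb'.
  exact: (open_prod_fspace (oQ i) (xa _ xa') (yb _ yb') Qab).
- by move=> i; have [s [sc se]] := Qsec i;
  exact: (@supported_in_section R d P m (Q i) s sc se).
Qed.

Theorem theorem4p3 (R : realType) (d : Order.disp_t) (P : finPOrderType d) :
  path_connected R (fspace P) ->
  (TCC R (product_cells (open_simplices R (order_complex P))
                        (open_simplices R (order_complex P)))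
     <= CC R P)%E.
Proof.
move=> _; apply: le_ereal_inf_tmp => _ [m _ <-].
(* For each [m], the admissible sizes [n] for [CC_cover P m] are admissible for [TCC_cover], and the
   infimum over a larger set is smaller; an empty set gives [+oo]. *)
apply: ereal_inf_le_tmp => _ [n Pn <-]; exists n => //.
exact: CC_cover_TCC_cover Pn.
Qed.
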